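(* Let $F\colon X\to Y\cup\{+\infty_Y\}$ be a proper $K$-convex mapping, let $C$ be a nonempty convex subset of $X$, and let $G\colon X\to Z\cup\{+\infty_Z\}$ be a proper $S$-convex mapping. Let $A:=C\cap G^{-1}(-S)$ and $E:=G(C\cap\operatorname{dom}F\cap\operatorname{dom}G)+S$. Assume that $A\cap\operatorname{dom}F\neq\emptyset$ and that one of the following conditions is fulfilled: $(c_1)$ there exists $x_0\in C\cap\operatorname{dom}F$ such that $G(x_0)\in-\operatorname{int}S$; $(c_2)$ $X,Z$ are Fréchet spaces, $C$ is closed, $y^*\circ F$ is lower semicontinuous for all $y^*\in Y^*$, $G$ is $S$-epi closed and $0_Z\in\operatorname{sqri}E$; $(c_3)$ $\dim\operatorname{lin}E<+\infty$ and $0_Z\in\operatorname{ri}E$. If $\bar x\in A$ is a solution of $(\mathrm{VOP})$, then there exists a solution $(\overline T,\bar y)$ of $(\mathrm{DVOP})$ such that $F(\bar x)=\bar y$.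
   Context: $X,Y,Z$ are (real) locally convex Hausdorff topological vector spaces with topological duals $X^*,Y^*,Z^*$; $K\subset Y$ is a closed, pointed, convex cone with $\operatorname{int}K\neq\emptyset$; $S\subset Z$ is a nonempty closed convex cone. Order and infinite elements: for $y_1,y_2\in Y$, $y_1<_K y_2$ means $y_1-y_2\in-\operatorname{int}K$. $Y^\bullet:=Y\cup\{-\infty_Y,+\infty_Y\}$, where $\pm\infty_Y\notin Y$ and $-\infty_Y<_K y<_K+\infty_Y$ for all $y\in Y$ (hence also $-\infty_Y<_K+\infty_Y$). Conventions: $(+\infty_Y)+y=y+(+\infty_Y)=+\infty_Y$ for $y\in Y\cup\{+\infty_Y\}$. Analogously $+\infty_Z$ is a greatest element attached to $Z$ (ordered by $S$). Weak supremum/infimum: for $\emptyset\neq M\subset Y^\bullet$, $\operatorname{WSup}M$ is the set of $\bar v\in Y^\bullet$ such that $\bar v\not<_K v$ for all $v\in M$, and for every $\tilde v\in Y^\bullet$ with $\tilde v<_K\bar v$ there is $v\in M$ with $\tilde v<_K v$. $\operatorname{WInf}M$ is the set of $\bar v\in Y^\bullet$ such that $v\not<_K\bar v$ for all $v\in M$, and for every $\tilde v\in Y^\bullet$ with $\bar v<_K\tilde v$ there is $v\in M$ with $v<_K\tilde v$. $\operatorname{WMin}M=M\cap\operatorname{WInf}M$ and $\operatorname{WMax}M=M\cap\operatorname{WSup}M$. Mappings: for $F\colon X\to Y^\bullet$, $\operatorname{dom}F=\{x\in X: F(x)\neq+\infty_Y\}$; $F$ is proper if $\operatorname{dom}F\neq\emptyset$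 and $-\infty_Y\notin F(X)$; $\operatorname{epi}_KF=\{(x,y)\in X\times Y: y\in F(x)+K\}$; $F$ is $K$-convex if $\operatorname{epi}_KF$ is convex, and $K$-epi closed if it is closed. The same notions are used for $G$ with $(Z,S)$ in place of $(Y,K)$. For $y^*\in Y^*$, $(y^*\circ F)(x)=y^*(F(x))$ if $F(x)\in Y$ and $+\infty$ if $F(x)=+\infty_Y$. $\mathcal{L}(Z,Y)$ is the space of continuous linear mappings $Z\to Y$. For $T\in\mathcal{L}(Z,Y)$, $(T\circ G)(x)=T(G(x))$ if $G(x)\in Z$ and $+\infty_Y$ if $G(x)=+\infty_Z$. $\mathcal{L}_+(S,K)=\{T\in\mathcal{L}(Z,Y): T(S)\subset K\}$. $(\mathrm{VOP})$ is the problem $\operatorname{WMin}\{F(x): x\in C,\ G(x)\in-S\}$; $\bar x\in A$ is a (weak) solution of it if $F(\bar x)\in\operatorname{WMin}F(A)$. $(\mathrm{DVOP})$ is the problem $\operatorname{WMax}\{y:(T,y)\in B\}$, where $$B=\{(T,y)\in\mathcal{L}_+(S,K)\times Y:\ y\notin(F+T\circ G)(C\cap\operatorname{dom}G)+\operatorname{int}K\},$$ i.e. $B$ is the set of $(T,y)\in\mathcal{L}_+(S,K)\times Y$ for which there is no $x\in C\cap\operatorname{dom}G$ with $(F+T\circ G)(x)<_K y$. A solution of $(\mathrm{DVOP})$ is a pair $(\overline T,\bar y)\in B$ with $\bar y\in\operatorname{WMax}\{y: (T,y)\in B \text{ for some } T\}$. For a convex set $U$: $\operatorname{lin}U$ is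 its linear hull, $\operatorname{ri}U$ its relative interior (interior relative to its affine hull), and $\operatorname{sqri}U$ its strong quasi-relative interior, i.e. the set of $u\in U$ such that the cone $\bigcup_{\lambda\ge 0}\lambda(U-u)$ is a closed linear subspace. *)

(* Defs.v *)
From HB Require Import structures.
From mathcomp Require Import all_boot all_order all_algebra.
From mathcomp Require Import all_classical all_reals all_analysis.

Set Implicit Arguments.
Unset Strict Implicit.
Unset Printing Implicit Defensive.

Import Order.TTheory GRing.Theory Num.Theory.
Import numFieldNormedType.Exports.

Local Open Scope classical_set_scope.
Local Open Scope ring_scope.

(* [tvsType R] is the class of locally convex topological vector spaces.
   [Y] with -oo_Y and +oo_Y adjoined is [\bar Y], the library's [extended Y];
   its addition is then the extension of the addition of [Y] and [er_map T] the
   extension of [T : Z -> Y] to [\bar Z -> \bar Y].  A map from [X] to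
   [Y] with +oo_Y adjoined is an [F : X -> \bar Y] that never takes the value
   -oo; this is part of [proper_mapping]. *)

Section Subsets.
Context {R : realType} {V : tvsType R}.
Implicit Types (K U L : set V).

(* For a nonempty closed set, asking for all t >= 0 or only for all t > 0
   gives the same notion. *)
Definition cone K := forall (t : R) x, 0 <= t -> K x -> K (t *: x).

Definition pointed K := K `&` (-%R @` K) = [set 0].

Definition linear_subspace L :=
  L 0 /\ forall (a : R) x y, L x -> L y -> L (a *: x + y).

Definition affine_subset L :=
  forall (a : R) x y, L x -> L y -> L ((1 - a) *: x + a *: y).

Definition lin U : set V := smallest linear_subspace U.

Definition aff U : set V := smallest affine_subset U.

Definition finite_dim L := exists2 B : set V, finite_set B & L = lin B.

Definition ri U : set V := [set u | U u /\ within (aff U) (nbhs u) U].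

Definition sqri U : set V := [set u | U u /\
  let P := [set z | exists (l : R) v, [/\ 0 <= l, U v & z = l *: (v - u)]] in
  closed P /\ linear_subspace P].

End Subsets.

(* A locally convex space is Frechet when its topology is induced by a
   complete translation-invariant metric.  The uniform structure carried by a
   [tvsType] is not required to be compatible with the addition, so the
   library's [cauchy] filters cannot be used to express completeness here. *)
Definition frechet {R : realType} (V : tvsType R) :=
  exists d : V -> V -> R,
    [/\ [/\ forall x y, d x y = 0 <-> x = y,
            forall x y, d x y = d y x &
            forall x y z, d x z <= d x y + d y z],
        forall x y z, d (x + z) (y + z) = d x y,
        forall x (U : set V), nbhs x U <->
          exists2 e : R, 0 < e & [set y | d x y < e] `<=` U &
        forall u : nat -> V,
          (forall e : R, 0 < e -> exists N : nat, forall m n : nat,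
             (N <= m)%N -> (N <= n)%N -> d (u m) (u n) < e) ->
          exists l : V, u @ \oo --> l].

Section WeakOrder.
Context {R : realType} {Y : tvsType R}.
Implicit Types (K : set Y) (M : set (\bar Y)).

Definition ltK K (u v : \bar Y) : Prop :=
  match u, v with
  | EFin a, EFin b => (-%R @` K°) (a - b)
  | EFin _, EPInf => True
  | ENInf, EFin _ => True
  | ENInf, EPInf => True
  | _, _ => False
  end.

Definition WSup K M : set (\bar Y) :=
  [set s | (forall v, M v -> ~ ltK K s v) /\
           (forall t, ltK K t s -> exists2 v, M v & ltK K t v)].

Definition WInf K M : set (\bar Y) :=
  [set s | (forall v, M v -> ~ ltK K v s) /\
           (forall t, ltK K s t -> exists2 v, M v & ltK K v t)].

Definition WMin K M : set (\bar Y) := M `&` WInf K M.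

Definition WMax K M : set (\bar Y) := M `&` WSup K M.

End WeakOrder.

Section Mappings.
Context {R : realType} {X V : tvsType R}.
Implicit Types (K : set V) (F : X -> \bar V).

Definition dom F : set X := [set x | F x <> +oo%E].

Definition proper_mapping F := dom F !=set0 /\ forall x, F x <> -oo%E.

Definition epi K F : set (X * V) :=
  [set p | exists2 k, K k & (p.2)%:E = (F p.1 + k%:E)%E].

Definition K_convex K F := convex_set (epi K F).

Definition K_epi_closed K F := closed (epi K F).

End Mappings.

Section Problems.
Context {R : realType} {X Y Z : tvsType R}.
Variables (K : set Y) (S : set Z) (C : set X).
Variables (F : X -> \bar Y) (G : X -> \bar Z).

Definition feasible : set X :=
  C `&` G @^-1` [set (- s)%:E | s in S].

Definition E_set : set Z :=
  [set z | exists x s,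
     (C `&` dom F `&` dom G) x /\ S s /\ z%:E = (G x + s%:E)%E].

Definition Lplus : set {linear Z -> Y} :=
  [set T : {linear Z -> Y} | continuous T /\ T @` S `<=` K].

Definition dual_feasible : set ({linear Z -> Y} * Y) :=
  [set p | Lplus p.1 /\
     ~ exists x k, [/\ (C `&` dom G) x, K° k &
         (p.2)%:E = (F x + er_map p.1 (G x) + k%:E)%E]].

Definition vop_solution (x : X) :=
  feasible x /\ WMin K (F @` feasible) (F x).

Definition dvop_solution (T : {linear Z -> Y}) (y : Y) :=
  dual_feasible (T, y) /\
  WMax K [set y'%:E | y' in [set y' | exists T', dual_feasible (T', y')]] y%:E.

Definition cond_c1 := exists x0,
  [/\ C x0, dom F x0 & [set (- s)%:E | s in S°] (G x0)].

Definition cond_c2 :=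
  [/\ frechet X /\ frechet Z, closed C,
      forall f : {scalar Y}, continuous f ->
        lower_semicontinuous (fun x => er_map f (F x)),
      K_epi_closed S G &
      sqri E_set 0].

Definition cond_c3 := finite_dim (lin E_set) /\ ri E_set 0.

End Problems.

(* Main.v *)
Require Import Defs.
From HB Require Import structures.
From mathcomp Require Import all_boot all_order all_algebra.
From mathcomp Require Import all_classical all_reals all_analysis.
From mathcomp Require Import ring lra.

Import numFieldNormedType.Exports.
Import Order.TTheory GRing.Theory Num.Theory.

Local Open Scope classical_set_scope.
Local Open Scope ring_scope.

Set Implicit Arguments.
Unset Strict Implicit.
Unset Printing Implicit Defensive.

(** Strong duality is reduced to the existence of a scalar Lagrange multiplier.

    Put $\bar y = F(\bar x)$. Weak minimality says that the convex set
    $Q = F(A) + K - \bar y$ misses $- int K$, so a continuous functional $f$ with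
    $f(k_0) = 1$ for a chosen $k_0 \in int K$ is nonnegative on $Q$
    ([scalarization]). Thus $\bar x$ minimizes the scalar function $f \circ F$
    over the feasible set. The value function
    $v(z) = \inf \{f(F(x)) - f(\bar y) : x \in C, G(x) \in z - S\}$ is convex
    and $v(0) = 0$; a continuous linear $l \le v$ is a Lagrange multiplier
    ([lagrange_multiplier]), and $T(z) = - l(z) k_0$ is the required operator:
    it maps $S$ into $K$ because $v \le 0$ on $S$, and $f \circ T = - l$ turns
    $l \le v$ into the dual feasibility of $(T, \bar y)$. Weak duality at
    $\bar x$ makes this pair optimal ([dual_feasible_value_solution]).

    All separation arguments go through one statement about convex relations
    $D$ between vectors and reals, seen as epigraphs: if $D$ has only
    nonnegative values over $0$ and is bounded near $0$, it lies above a
    continuous linear functional ([bounded_linear_minorant]). This is the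
    Hahn-Banach theorem, obtained here from a maximal convex cone with
    nonnegative fibre over $0$ ([conic_linear_minorant]). For the value
    function the domain generates a linear subspace $P$ only, and it suffices
    that $v$ is bounded on the trace on $P$ of a neighbourhood of $0$
    ([subspace_linear_minorant]). That boundedness is what the three constraint
    qualifications provide. Under $(c_1)$ the Slater point bounds $v$ near $0$ in
    the whole space. Under $(c_3)$, $v$ is bounded on a segment in each of
    finitely many directions spanning $P$ ([finite_dim_absorbing_bounded]).
    Under $(c_2)$, the pairs $(x, z)$ with $x \in C$, $G(x) \in z - S$ and
    $f(F(x)) \le f(\bar y) + 1$ form a closed convex set whose projection
    absorbs the Frechet space $P$; by Baire's theorem and a successive
    approximation this projection is a neighbourhood of $0$ in $P$
    ([convex_range_nbhs]). *)

(** * Linear minorants of sublinear relations *)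

Section ConicMinorant.
Context {R : realType} {V : lmodType R}.
Implicit Types (A B D : set (V * R)).

Definition conic A :=
  (forall x y r s, A (x, r) -> A (y, s) -> A (x + y, r + s)) /\
  (forall t x r, 0 <= t -> A (x, r) -> A (t *: x, t * r)).

Definition nonneg_at0 A := forall r, A (0, r) -> 0 <= r.

Lemma maximal_conic D : conic D -> nonneg_at0 D -> D !=set0 ->
  exists A, [/\ D `<=` A, conic A, nonneg_at0 A &
    forall B, A `<=` B -> conic B -> nonneg_at0 B -> B `<=` A].
Proof.
move=> cD pD D0.
(* The guard admits the empty set, which is the union of the empty chain. *)
pose P A := [/\ A !=set0 -> D `<=` A, conic A & nonneg_at0 A].
have chain (F : set (set (V * R))) : F `<=` P -> total_on F subset ->
    P (\bigcup_(X in F) X).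
  move=> FP Ft; split.
  - move=> [p [X FX Xp]] q Dq; exists X => //.
    by have [+ _ _] := FP _ FX; apply => //; exists p.
  - split=> [x y r s [X FX Xx] [X' FX' Xy]|t x r t0 [X FX Xx]].
      have [XX'|X'X] := Ft _ _ FX FX'.
        by exists X' => //; have [_ [+ _] _] := FP _ FX'; apply => //; exact: XX'.
      by exists X => //; have [_ [+ _] _] := FP _ FX; apply => //; exact: X'X.
    by exists X => //; have [_ [_ +] _] := FP _ FX; apply.
  - by move=> r [X FX Xr]; have [_ _] := FP _ FX; apply.
have [A [[DA cA pA] Amax]] := Zorn_bigcup chain.
have A0 : A !=set0.
  apply/set0P/eqP => A0; have [p Dp] := D0.
  apply: (Amax D); last by split=> // _; exact: subset_refl.
  by rewrite A0; split=> [|DA0]; [exact: sub0set|exact: (DA0 p Dp)].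
exists A; split => //; first exact: DA.
move=> B AB cB pB; apply: contrapT => BA.
apply: (Amax B); first by split.
by split => // _; apply: subset_trans AB; exact: DA.
Qed.

(** With $D$ the epigraph of a sublinear function this is the Hahn-Banach
    theorem. In a maximal conic relation a pair $(a, s)$ that is missing lies strictly
    below the graph, and then $(-a, -s)$ lies strictly above it: this is what
    makes the infimum along the fibres odd, hence linear. *)
Theorem conic_linear_minorant D : conic D -> nonneg_at0 D ->
  (forall x, exists r, D (x, r)) ->
  exists l : {scalar V}, forall x r, D (x, r) -> l x <= r.
Proof.
move=> cD pD Dfull.
have D0 : D !=set0 by have [r Dr] := Dfull 0; exists (0, r).
have [A [DA [Aadd Ascale] pA Amax]] := maximal_conic cD pD D0.
have Afull x : exists r, A (x, r) by have [r /DA] := Dfull x; exists r.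
have A00 : A (0, 0).
  by have [r /(Ascale 0 _ _ (lexx _))] := Afull 0; rewrite scaler0 mul0r.
have missing a s : ~ A (a, s) -> exists2 s', A (- a, s') & s' < - s.
  move=> nA; apply: contrapT => noneg; apply: nA.
  have above u : A (- a, u) -> - s <= u.
    by move=> Au; rewrite leNgt; apply/negP => us; apply: noneg; exists u.
  pose B := [set p | exists x r t,
    [/\ A (x, r), 0 <= t & p = (x + t *: a, r + t * s)]].
  apply: (Amax B).
  - by move=> [x r] Ax; exists x, r, 0; rewrite scale0r mul0r !addr0.
  - split.
      move=> x y r s' [x1 [r1 [t1 [A1 t10 [-> ->]]]]] [x2 [r2 [t2 [A2 t20 [-> ->]]]]].
      exists (x1 + x2), (r1 + r2), (t1 + t2); split; [exact: Aadd|exact: addr_ge0|].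
      by rewrite scalerDl mulrDl !addrA ![_ + _ + x2]addrAC ![_ + _ + r2]addrAC.
    move=> t x r t0 [x1 [r1 [t1 [A1 t10 [-> ->]]]]].
    exists (t *: x1), (t * r1), (t * t1); split; [exact: Ascale|exact: mulr_ge0|].
    by rewrite scalerDr mulrDr scalerA mulrA.
  - move=> r [x [r1 [t [A1 t0 [/esym xE ->]]]]].
    have {xE}xE : x = - (t *: a) by apply/eqP; rewrite -addr_eq0 xE.
    move: t0; rewrite le_eqVlt => /predU1P[t0|t0].
      apply: pA; move: A1; rewrite xE -t0 scale0r mul0r oppr0 addr0.
      by [].
    have /above : A (- a, t^-1 * r1).
      have := Ascale t^-1 x r1 (ltW _) A1; rewrite invr_gt0 => /(_ t0).
      by rewrite xE scalerN scalerA mulVf ?scale1r// gt_eqF.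
    by rewrite mulrC ler_pdivlMr// mulNr mulrC lerNl -subr_ge0 opprK addrC mulrC.
  - by exists 0, 0, 1; rewrite scale1r mul1r !add0r.
pose fib x := [set r | A (x, r)].
have fib0 x : fib x !=set0 by have [r] := Afull x; exists r.
have fib_inf x : has_inf (fib x).
  split => //; have [s As] := Afull (- x); exists (- s) => r Ar.
  by rewrite -subr_ge0 opprK; apply: pA; rewrite -(subrr x); exact: Aadd.
pose l x := inf (fib x).
have lle x r : A (x, r) -> l x <= r by move=> Ax; apply: ge_inf => //; case: (fib_inf x).
have lge x c : (forall r, A (x, r) -> c <= r) -> c <= l x.
  by move=> h; exact: lb_le_inf.
clearbody l.
have lN x : l (- x) <= - l x.
  rewrite leNgt; apply/negP => lx.
  have [s' As' s'l] : exists2 s', A (- x, s') & s' < l (- x).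
    have /missing : ~ A (x, - l (- x)) by move/lle; rewrite leNgt ltrNl lx.
    by rewrite opprK.
  by have := lle _ _ As'; rewrite leNgt s'l.
have lD x y : l (x + y) <= l x + l y.
  rewrite -lerBlDl; apply: (lge) => s As; rewrite lerBlDl -lerBlDr.
  by apply: (lge) => r Ar; rewrite lerBlDr; exact/lle/Aadd.
have lZ t x : 0 <= t -> l (t *: x) <= t * l x.
  rewrite le_eqVlt => /predU1P[<-|t0].
    by rewrite scale0r mul0r; exact: lle.
  rewrite mulrC -ler_pdivrMr//; apply: lge => r Ar; rewrite ler_pdivrMr// mulrC.
  by apply: lle; apply: Ascale => //; exact: ltW.
have l0 : l 0 = 0.
  by apply/eqP; rewrite eq_le lle//=; apply: lge => r; exact: pA.
have lNE x : l (- x) = - l x.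
  apply/eqP; rewrite eq_le lN/= -subr_ge0 opprK.
  by rewrite -l0 -(subrr x) addrC; exact: lD.
have lDE x y : l (x + y) = l x + l y.
  apply/eqP; rewrite eq_le lD/= -lerN2 -lNE opprD (le_trans (lD _ _))//.
  by rewrite !lNE opprD.
have lZpE t x : 0 <= t -> l (t *: x) = t * l x.
  move=> t0; apply/eqP; rewrite eq_le lZ//= -lerN2 -lNE -scalerN.
  by rewrite (le_trans (lZ _ _ t0))// lNE mulrN.
have lZE t x : l (t *: x) = t * l x.
  have [|t0] := leP 0 t; first exact: lZpE.
  have := lZpE (- t) x; rewrite oppr_ge0 ltW// => /(_ isT).
  by rewrite scaleNr lNE mulNr => /oppr_inj.
have llin : linear_for *%R (l : V -> R^o) by move=> t x y; rewrite lDE lZE.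
pose lM := GRing.isLinear.Build R V R^o *%R (l : V -> R^o) llin.
pose L : {scalar V} := HB.pack (l : V -> R^o) lM.
by exists L => x r /DA /lle.
Qed.

End ConicMinorant.

(** * Convexity and neighbourhoods in locally convex spaces *)

Lemma convex_setP (R : realType) (V : lmodType R) (A : set V) :
  convex_set A <-> forall a b x y, 0 <= a -> 0 <= b -> a + b = 1 ->
    A x -> A y -> A (a *: x + b *: y).
Proof.
split=> [cA a b x y a0 b0 ab Ax Ay|cA x y k /set_mem Ax /set_mem Ay].
  have b1 : b = 1 - a by rewrite -ab addrC addKr.
  have a01 : 0 <= a <= 1 by rewrite a0 -subr_ge0 -b1.
  pose k : {i01 R} := Itv01 a0 (proj2 (andP a01)).
  have := cA x y k; rewrite b1 => h.
  by apply/set_mem/h; exact/mem_set.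
apply/mem_set; apply: cA => //; last by rewrite addrC subrK.
by rewrite subr_ge0.
Qed.

Lemma convex_combination_sub (R : realType) (V : lmodType R) (a b : R) (x y v : V) :
  a + b = 1 -> a *: x + b *: y - v = a *: (x - v) + b *: (y - v).
Proof. by move=> ab; rewrite !scalerBr addrACA -opprD -scalerDl ab scale1r. Qed.

Section Neighbourhoods.
Context {R : realType} {V : tvsType R}.
Implicit Types (N : set V) (x : V).

Lemma nbhs0_absorbing N x : nbhs 0 N ->
  exists2 t : R, 0 < t & forall s, `|s| <= t -> N (s *: x).
Proof.
move=> N0; have /= := @scale_continuous R V (0, x) N.
rewrite scale0r => /(_ N0)[[A B] /= [A0 Bx] AB].
have [e /= e0 eA] := A0.
exists (e / 2); first by rewrite divr_gt0.
move=> s se; apply: (AB (s, x)); split => /=; last exact: nbhs_singleton.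
by apply: eA; rewrite /= sub0r normrN (le_lt_trans se)// ltr_pdivrMr// ltr_pMr// ltr1n.
Qed.

Lemma nbhs_add N x : nbhs x N -> nbhs 0 [set u | N (x + u)].
Proof.
move=> /(nbhsB (- x)); rewrite addNr; apply: filterS => u [v Nv <-] /=.
by rewrite addrA addrN add0r.
Qed.

Lemma nbhs_sub N x : nbhs 0 N -> nbhs x [set u | N (u - x)].
Proof.
move=> /(nbhsT x); apply: filterS => u [v Nv <-] /=.
by rewrite addrC addKr.
Qed.

Lemma nbhs0_scale N (t : R) : t != 0 -> nbhs 0 N -> nbhs 0 [set u | N (t *: u)].
Proof.
move=> t0 N0; have ti0 : t^-1 != 0 by rewrite invr_eq0.
apply: filterS (nbhs0Z ti0 N0) => u [v Nv <-] /=.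
by rewrite scalerA divff// scale1r.
Qed.

Lemma nbhs0_opp N : nbhs 0 N -> nbhs 0 [set u | N (- u)].
Proof. by move=> /nbhs0N; apply: filterS => u [v Nv <-] /=; rewrite opprK. Qed.

Lemma nbhs0_convex_symmetric N : nbhs 0 N -> exists U : set V,
  [/\ nbhs 0 U, U `<=` N, convex_set U & forall u, U u -> U (- u)].
Proof.
move=> N0; have [B Bconvex [Bopen Bbasis]] := @locally_convex R V.
have [b [Bb b0] bN] := Bbasis 0 N N0.
have nb : nbhs 0 b by apply: open_nbhs_nbhs; split => //; exact: Bopen.
exists (b `&` [set u | b (- u)]); split.
- by apply: filterI => //; exact: nbhs0_opp.
- by move=> u [/bN].
- apply/convex_setP => s t x y s0 t0 st [bx bNx] [yb bNy].
  have /convex_setP bconvex : convex_set b by apply: Bconvex; exact: mem_set.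
  by split=> /=; rewrite ?opprD -?scalerN; exact: bconvex.
- by move=> u [bu bNu]; split => //=; rewrite opprK.
Qed.

Lemma convex_set_scale_le (U : set V) (t : R) x :
  convex_set U -> U 0 -> 0 <= t <= 1 -> U x -> U (t *: x).
Proof.
move=> /convex_setP cU U0 /andP[t0 t1] Ux.
have := cU t (1 - t) x 0 t0; rewrite subr_ge0 addrC subrK scaler0 addr0.
by apply.
Qed.

Lemma scalar_bounded_continuous (l : {scalar V}) N (M : R) :
  nbhs 0 N -> (forall x, N x -> l x <= M) -> continuous l.
Proof.
move=> N0 lM x.
have M0 : 0 <= M by rewrite -(linear0 l); apply: (lM); exact: (nbhs_singleton N0).
have M1 : 0 < M + 1 by rewrite ltr_wpDl.
apply/cvgrPdist_lt => e e0.
pose c := (M + 1) / e.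
have c0 : 0 < c by rewrite divr_gt0.
have Ni : nbhs 0 (N `&` [set u | N (- u)]).
  by apply: filterI => //; exact: nbhs0_opp.
have := nbhs_sub x (nbhs0_scale (lt0r_neq0 c0) Ni).
apply: filterS => y /= [Ny NNy].
have lc : `|c * (l x - l y)| <= M.
  have -> : c * (l x - l y) = - l (c *: (y - x)).
    by rewrite linearZ linearB/= -mulrN opprB.
  by rewrite normrN ler_norml lM// andbT lerNl -linearN lM.
rewrite -(ltr_pM2l c0) -(gtr0_norm c0) -normrM (gtr0_norm c0).
rewrite (le_lt_trans lc)// /c divfK ?gt_eqF//.
by rewrite ltrDl.
Qed.

End Neighbourhoods.

(** * Continuous linear minorants of convex relations *)

Section ContinuousMinorant.
Context {R : realType} {V : tvsType R}.
Implicit Types (D : set (V * R^o)) (N P : set V).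

(** The bound on $N$ serves twice: the cone generated by $D$ then has a point
    over every vector, and the linear minorant is bounded above on $N$, hence
    continuous. *)
Theorem bounded_linear_minorant D N (M : R) :
  convex_set D -> nonneg_at0 D -> nbhs 0 N -> (forall z, N z -> D (z, M)) ->
  exists2 l : {scalar V}, continuous l & forall z r, D (z, r) -> l z <= r.
Proof.
move=> /convex_setP cD pD N0 DN.
pose A : set (V * R) := [set p | exists t z r,
  [/\ 0 <= t, D (z, r) & p = (t *: z, t * r)]].
have Acone : conic A.
  split.
    move=> x y r s [t1 [x1 [r1 [t10 D1 [-> ->]]]]] [t2 [x2 [r2 [t20 D2 [-> ->]]]]].
    have := addr_ge0 t10 t20; rewrite le_eqVlt => /predU1P[/esym/eqP|t0].
      rewrite paddr_eq0// => /andP[/eqP -> /eqP ->].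
      by exists 0, x1, r1; split => //; rewrite !scale0r !mul0r !addr0.
    have ab : t1 / (t1 + t2) + t2 / (t1 + t2) = 1.
      by rewrite -mulrDl divff// gt_eqF.
    exists (t1 + t2), ((t1 / (t1 + t2)) *: x1 + (t2 / (t1 + t2)) *: x2),
      (t1 / (t1 + t2) * r1 + t2 / (t1 + t2) * r2); split; first exact: ltW.
      by apply: (cD _ _ (x1, r1) (x2, r2)) => //; rewrite divr_ge0// ltW.
    have tn0 : t1 + t2 != 0 by rewrite gt_eqF.
    congr (_, _); last by field.
    by rewrite scalerDr !scalerA ![(t1 + t2) * _]mulrC !divfK.
  move=> t x r t0 [t1 [x1 [r1 [t10 D1 [-> ->]]]]].
  by exists (t * t1), x1, r1; rewrite scalerA mulrA; split => //; exact: mulr_ge0.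
have A0 : nonneg_at0 A.
  move=> r [t [z [r1 [t0 Dz [/esym/eqP + ->]]]]].
  rewrite scaler_eq0 => /orP[/eqP -> |/eqP z0]; first by rewrite mul0r.
  by apply: mulr_ge0 => //; apply: pD; rewrite -z0.
have Afull x : exists r, A (x, r).
  have [t t0 tN] := nbhs0_absorbing x N0.
  exists (t^-1 * M), t^-1, (t *: x), M; split.
  - by rewrite invr_ge0 ltW.
  - by apply/DN/tN; rewrite gtr0_norm.
  - by rewrite scalerA mulVf ?scale1r// gt_eqF.
have [l lA] := conic_linear_minorant Acone A0 Afull.
have lD z r : D (z, r) -> l z <= r.
  by move=> Dz; apply: lA; exists 1, z, r; rewrite scale1r mul1r ler01.
exists l => //.
by apply: (scalar_bounded_continuous N0) => z /DN; exact: lD.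
Qed.

(** Adding to $D$ the cone generated by $U \times \{M\}$, for a convex and
    symmetric neighbourhood $U \subset N$ of $0$, turns a bound on
    $N \cap P$ into a bound on all of $N$, without creating negative values
    over $0$. *)
Theorem subspace_linear_minorant D N P (M : R) :
  convex_set D -> nonneg_at0 D -> linear_subspace P ->
  (forall z r, D (z, r) -> P z) ->
  nbhs 0 N -> (forall z, N z -> P z -> D (z, M)) ->
  exists2 l : {scalar V}, continuous l & forall z r, D (z, r) -> l z <= r.
Proof.
move=> /convex_setP cD pD [P0 Plin] DP N0 DN.
have [U [U0 UN /convex_setP cU symU]] := nbhs0_convex_symmetric N0.
pose D' : set (V * R^o) := [set p | exists z r t u,
  [/\ D (z, r), 0 <= t, U u & p = (z + t *: u, r + t * M)]].
have D00 : D (0, M) by apply: DN => //; exact: nbhs_singleton.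
have D'D z r : D (z, r) -> D' (z, r).
  move=> Dz; exists z, r, 0, 0; split => //; first exact: nbhs_singleton.
  by rewrite scaler0 mul0r !addr0.
suff [l lc lD'] : exists2 l : {scalar V}, continuous l &
    forall z r, D' (z, r) -> l z <= r by exists l => // z r /D'D; exact: lD'.
apply: (@bounded_linear_minorant D' U (M + M)) => //; last first.
- move=> u Uu; exists 0, M, 1, u; split => //.
  by rewrite scale1r mul1r add0r.
- move=> r [z [s [t [u [Dz t0 Uu [/esym/eqP zu ->]]]]]].
  move: zu; rewrite addr_eq0 => /eqP zE.
  move: t0; rewrite le_eqVlt => /predU1P[t0|t0].
    by move: Dz; rewrite zE -t0 scale0r mul0r addr0 oppr0; exact: pD.
  have Pu : P u.
    have -> : u = - t^-1 *: z + 0.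
      by rewrite zE scaleNr scalerN opprK scalerA mulVf ?scale1r ?addr0// gt_eqF.
    by apply: Plin => //; exact: DP Dz.
  have Du : D (u, M) by apply: DN => //; exact: UN.
  have t1 : 0 < 1 + t by rewrite addr_gt0.
  have t1n : 1 + t != 0 by rewrite gt_eqF.
  have := cD ((1 + t)^-1) (t / (1 + t)) (z, s) (u, M) _ _ _ Dz Du.
  rewrite invr_ge0 divr_ge0 ?(ltW t0) ?(ltW t1)// => /(_ isT isT).
  have -> : (1 + t)^-1 + t / (1 + t) = 1 by field.
  move=> /(_ erefl); rewrite /=.
  rewrite (_ : _ + _ = (0, (1 + t)^-1 * (s + t * M))); last first.
    congr (_, _); last by rewrite /= /GRing.scale /=; field.
    change ((1 + t)^-1 *: z + (t / (1 + t)) *: u = 0).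
    by rewrite zE scalerN scalerA [t / _]mulrC addNr.
  by move/pD; rewrite pmulr_rge0 ?invr_gt0.
apply/convex_setP => a b p q a0 b0 ab
  [z1 [r1 [t1 [u1 [Dz1 t10 Uu1 ->]]]]] [z2 [r2 [t2 [u2 [Dz2 t20 Uu2 ->]]]]].
exists (a *: z1 + b *: z2), (a * r1 + b * r2), (a * t1 + b * t2).
have at10 : 0 <= a * t1 by rewrite mulr_ge0.
have bt20 : 0 <= b * t2 by rewrite mulr_ge0.
have Dab : D (a *: z1 + b *: z2, a * r1 + b * r2).
  exact: (cD _ _ (z1, r1) (z2, r2)).
have /predU1P[/esym/eqP t0|t0] :
    (0 == a * t1 + b * t2) || (0 < a * t1 + b * t2) by rewrite -le_eqVlt addr_ge0.
  exists 0; split; [exact: Dab|by rewrite addr_ge0|exact: nbhs_singleton|].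
  move: (t0); rewrite paddr_eq0// => /andP[/eqP at1 /eqP bt2].
  rewrite (eqP t0) scale0r mul0r !addr0.
  congr (_, _) => /=.
    by rewrite !scalerDr !scalerA at1 bt2 !scale0r !addr0.
  by rewrite /GRing.scale/= !mulrDr !mulrA at1 bt2 !mul0r !addr0.
set t := _ + _ in t0 *; have tn0 : t != 0 by rewrite gt_eqF.
exists ((a * t1 / t) *: u1 + (b * t2 / t) *: u2); split => //.
- exact: ltW.
- by apply: cU => //; rewrite ?divr_ge0// ?ltW// -mulrDl divff.
- congr (_, _) => /=.
    rewrite !scalerDr !scalerA ![t * _]mulrC !divfK//.
    by rewrite -!addrA; congr (_ + _); rewrite addrCA.
  by rewrite /GRing.scale/= /t; ring.
Qed.

(** A minorant $l$ of the relation $D$ in the proof, which contains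
    $U \times \{1\}$ and $(-b, -1)$, satisfies $l(b) \ge 1$; the relation is
    nonnegative over $0$ because $b \notin U$. *)
Lemma scalar_separation (hV : hausdorff_space V) (b : V) : b != 0 ->
  exists2 h : {scalar V}, continuous h & h b = 1.
Proof.
move=> b0.
have [N N0 Nb] : exists2 N, nbhs 0 N & ~ N b.
  apply: contrapT => noN; move/eqP: b0; apply; apply/esym/hV => A B A0 Bb.
  exists b; split; last exact: nbhs_singleton.
  by apply: contrapT => Ab; apply: noN; exists A.
have [U [U0 UN Uconv symU]] := nbhs0_convex_symmetric N0.
have U00 : U 0 by exact: nbhs_singleton.
pose D : set (V * R^o) := [set p | exists t u s,
  [/\ 0 <= t, U u, 0 <= s & p = (t *: u - s *: b, t - s)]].
have [||z Uz|l lc lD] := @bounded_linear_minorant D U 1 _ _ U0.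
- apply/convex_setP => a c p q a0 c0 ac
    [t1 [u1 [s1 [t10 Uu1 s10 ->]]]] [t2 [u2 [s2 [t20 Uu2 s20 ->]]]].
  have at10 : 0 <= a * t1 by rewrite mulr_ge0.
  have ct20 : 0 <= c * t2 by rewrite mulr_ge0.
  exists (a * t1 + c * t2).
  have /predU1P[/esym/eqP t0|t0] :
      (0 == a * t1 + c * t2) || (0 < a * t1 + c * t2).
    by rewrite -le_eqVlt addr_ge0.
    exists 0, (a * s1 + c * s2); split => //; first by rewrite addr_ge0.
      by rewrite addr_ge0// mulr_ge0.
    move: (t0); rewrite paddr_eq0// => /andP[/eqP at1 /eqP ct2].
    rewrite (eqP t0) scale0r !sub0r; congr (_, _) => /=.
      by rewrite !scalerDr !scalerN !scalerA at1 ct2 !scale0r !sub0r scalerDl opprD.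
    by rewrite /GRing.scale/= !mulrDr at1 ct2 !mulrN !sub0r opprD.
  set t := _ + _ in t0 *; have tn0 : t != 0 by rewrite gt_eqF.
  exists ((a * t1 / t) *: u1 + (c * t2 / t) *: u2), (a * s1 + c * s2); split => //.
  + exact: ltW.
  + move/convex_setP : Uconv; apply => //; rewrite ?divr_ge0// ?ltW//.
    by rewrite -mulrDl divff.
  + by rewrite addr_ge0// mulr_ge0.
  + congr (_, _) => /=.
      rewrite !scalerDr !scalerN !scalerA ![t * _]mulrC !divfK// scalerDl opprD.
      by rewrite addrACA.
    by rewrite /GRing.scale/= /t; ring.
- move=> r [t [u [s [t0 Uu s0 [/esym/eqP + ->]]]]].
  rewrite subr_eq0 subr_ge0 => /eqP ub; rewrite leNgt; apply/negP => ts.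
  have sp : 0 < s by exact: le_lt_trans ts.
  apply: Nb; apply: UN.
  have -> : b = (t / s) *: u.
    by rewrite mulrC -scalerA ub scalerA mulVf ?scale1r// gt_eqF.
  apply: convex_set_scale_le => //.
  by rewrite divr_ge0//= ler_pdivrMr// mul1r ltW.
- by exists 1, z, 0; rewrite ler01 scale1r scale0r !subr0.
have lb : 1 <= l b.
  have : l (- b) <= -1.
    by apply: lD; exists 0, 0, 1; rewrite ler01 scaler0 scale1r !sub0r.
  by rewrite linearN lerN2.
have lb0 : l b != 0 by rewrite gt_eqF// (lt_le_trans ltr01).
pose h : {scalar V} := (l b)^-1 \*: l.
exists h; last by rewrite /h /= /GRing.scale/= mulVf.
move=> x; apply: (@cvgM _ _ _ _ (fun=> (l b)^-1) l); first exact: cvg_cst.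
exact: lc.
Qed.

End ContinuousMinorant.

(** * Convex relations over finite-dimensional subspaces *)

Section FiniteRank.
Context {R : realType} {V : tvsType R}.
Implicit Types (D : set (V * R^o)) (P : set V).

Lemma lin_linear_subspace (U : set V) : linear_subspace (lin U).
Proof.
split=> [L [[L0 _] _]//|a x y Ux Uy L LU].
by have [[_ Llin] _] := LU; apply: Llin; [exact: Ux|exact: Uy].
Qed.

Lemma linear_subspace_scale P (a : R) x : linear_subspace P -> P x -> P (a *: x).
Proof. by move=> [P0 Plin] Px; rewrite -[_ *: _]addr0; exact: Plin. Qed.

(** Inductive sums of maps $z \mapsto h(z) e$ spare the bookkeeping of indexed
    families of functionals and vectors. *)
Inductive finite_rank P : (V -> V) -> Prop :=
| finite_rank0 : finite_rank P (fun=> 0)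
| finite_rankD pi (h : {scalar V}) e : finite_rank P pi -> continuous h ->
    P e -> finite_rank P (fun z => pi z + h z *: e).

Lemma finite_rank_linear P pi : finite_rank P pi ->
  forall a x y, pi (a *: x + y) = a *: pi x + pi y.
Proof.
elim=> [a x y|{}pi h e _ IH _ _ a x y]; first by rewrite scaler0 addr0.
by rewrite IH linearP/= scalerDl scalerDr scalerA addrACA.
Qed.

Lemma finite_rank_at0 P pi : finite_rank P pi -> pi 0 = 0.
Proof.
move=> piP; have := finite_rank_linear piP (-1) 0 0.
by rewrite scaler0 addr0 scaleN1r addNr.
Qed.

Lemma finite_rank_sub P pi x : linear_subspace P -> finite_rank P pi -> P (pi x).
Proof.
move=> [P0 Plin]; elim=> // {}pi h e _ Ppi _ Pe.
by rewrite addrC; exact: Plin.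
Qed.

Lemma finite_rank_comp P pi (h : {scalar V}) : finite_rank P pi ->
  exists2 k : {scalar V}, continuous k & forall z, k z = h (pi z).
Proof.
elim=> [|{}pi g e _ [k kc kE] gc _].
  exists (\0 : {scalar V}) => [x|z]; last by rewrite linear0.
  exact: cvg_cst.
exists (k \+ h e \*: g : {scalar V}) => [x|z].
  apply: (@cvgD _ _ _ _ _ k (h e \*: g)); first exact: kc.
  by apply: (@cvgM _ _ _ _ (fun=> h e) g); [exact: cvg_cst|exact: gc].
by rewrite linearD linearZ/= kE /GRing.scale/= [g z * _]mulrC.
Qed.

(** If $\pi$ fixes the vectors treated so far and $h(b - \pi(b)) = 1$, then
    $h - h \circ \pi$ vanishes on these vectors and is $1$ at $b$, so that adding
    $(h - h \circ \pi) (b - \pi(b))$ to $\pi$ corrects it at $b$ only. *)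
Lemma finite_rank_projection P (s : seq V) : hausdorff_space V ->
  linear_subspace P -> (forall b, b \in s -> P b) ->
  exists2 pi, finite_rank P pi & forall b, b \in s -> pi b = b.
Proof.
move=> hV Plin; elim: s => [_|b s IH sP].
  by exists (fun=> 0) => //; exact: finite_rank0.
have [|pi piP pis] := IH; first by move=> c cs; apply: sP; rewrite inE cs orbT.
have piB x y : pi (x - y) = pi x - pi y.
  by rewrite addrC -scaleN1r (finite_rank_linear piP) scaleN1r addrC.
have [b0|b0] := eqVneq (b - pi b) 0.
  exists pi => // c; rewrite inE => /predU1P[->|/pis//].
  by apply/eqP; rewrite eq_sym -subr_eq0 b0.
have Pb : P b by apply: sP; rewrite mem_head.
have Pb' : P (b - pi b).
  by rewrite addrC -scaleN1r; apply: (proj2 Plin) => //; exact: (finite_rank_sub b Plin piP).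
have [h hc hb] := scalar_separation hV b0.
have [k kc kE] := finite_rank_comp h piP.
pose g : {scalar V} := h \- k.
have gE x : g x = h (x - pi x) by rewrite linearB /= kE.
exists (fun z => pi z + g z *: (b - pi b)).
  apply: finite_rankD => // x.
  by apply: (@cvgB _ _ _ _ _ h k); [exact: hc|exact: kc].
move=> c; rewrite inE => /predU1P[->|cs].
  by rewrite gE hb scale1r addrC subrK.
by rewrite gE pis// subrr linear0 scale0r addr0.
Qed.

(** Along each direction $e$ of $P$ the relation is bounded on a segment around
    $0$, and finitely many such segments span a neighbourhood. *)
Lemma finite_rank_bounded D P pi : convex_set D ->
  (forall z r s, D (z, r) -> r <= s -> D (z, s)) -> linear_subspace P ->
  (forall e, P e -> exists t r, 0 < t /\ D (t *: e, r)) ->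
  finite_rank P pi ->
  exists N M, nbhs 0 N /\ forall z, N z -> D (pi z, M).
Proof.
move=> /convex_setP cD upD Plin absD.
have [r0 D0] : exists r0, D (0, r0).
  by have [t [r [_]]] := absD 0 (proj1 Plin); rewrite scaler0; exists r.
have ray t e r c : 0 < t -> D (t *: e, r) -> 0 <= c <= t ->
    D (c *: e, Num.max r r0).
  move=> t0 De /andP[c0 ct].
  have ct0 : 0 <= c / t by rewrite divr_ge0// ltW.
  have ct1 : 0 <= 1 - c / t by rewrite subr_ge0 ler_pdivrMr// mul1r.
  have := cD (c / t) (1 - c / t) (t *: e, Num.max r r0) (0, Num.max r r0) ct0 ct1.
  have -> : c / t + (1 - c / t) = 1 by rewrite addrC subrK.
  have -> : (c / t) *: (t *: e, Num.max r r0) + (1 - c / t) *: (0, Num.max r r0) =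
      (c *: e, Num.max r r0) :> V * R^o.
    congr (_, _) => /=.
      by rewrite scalerA divfK ?gt_eqF// scaler0 addr0.
    by rewrite -scalerDl addrC subrK scale1r.
  by apply => //; [apply: (upD _ _ _ De)|apply: (upD _ _ _ D0)];
    rewrite le_max lexx ?orbT.
elim=> [|{}pi h e piP [N [M [N0 DN]]] hc Pe].
  by exists setT, r0; split=> //; exact: filterT.
have [t1 [r1 [t10 De1]]] := absD _ Pe.
have [t2 [r2 [t20 De2]]] : exists t r, 0 < t /\ D (t *: - e, r).
  by apply: absD; rewrite -scaleN1r; exact: linear_subspace_scale.
pose t := Num.min t1 t2.
have t0 : 0 < t by rewrite lt_min t10.
pose M' := Num.max (Num.max r1 r0) (Num.max r2 r0).
have De c : `|c| <= t -> D (c *: e, M').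
  rewrite le_min => /andP[ct1 ct2].
  have [c0|c0] := leP 0 c.
    apply: (@upD _ (Num.max r1 r0)); last by rewrite le_max lexx.
    by apply: (ray t1) => //; rewrite c0 -(ger0_norm c0).
  apply: (@upD _ (Num.max r2 r0)); last by rewrite le_max lexx orbT.
  rewrite -[c]opprK scaleNr -scalerN; apply: (ray t2) => //.
  by rewrite oppr_ge0 (ltW c0)/= -(ltr0_norm c0).
(* $\pi(z) + h(z) e$ is the midpoint of $\pi(2 z)$ and $h(2 z) e$. *)
exists ([set z | N (2 *: z)] `&` [set z | `|h (2 *: z)| <= t]), (2^-1 * M + 2^-1 * M').
split.
  apply: filterI; first exact: nbhs0_scale.
  have hN : nbhs 0 [set z | `|h z| <= t].
    have /cvgrPdist_le/(_ _ t0) := hc 0; rewrite linear0.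
    by apply: filterS => z /=; rewrite sub0r normrN.
  exact: (nbhs0_scale _ hN).
move=> z [/DN DN2 /De De2'].
have h0 : 0 <= 2^-1 :> R by rewrite invr_ge0.
have h1 : 2^-1 + 2^-1 = 1 :> R by lra.
have := cD _ _ _ _ h0 h0 h1 DN2 De2'.
congr (D (_, _)) => /=.
have pi0 := finite_rank_at0 piP.
have -> : pi (2 *: z) = 2 *: pi z.
  by have := finite_rank_linear piP 2 z 0; rewrite pi0 !addr0.
by rewrite [h _]linearZ/= !scalerA mulrA mulVf// !scale1r mul1r.
Qed.

Lemma finite_dim_absorbing_bounded D P : hausdorff_space V -> convex_set D ->
  (forall z r s, D (z, r) -> r <= s -> D (z, s)) ->
  finite_dim P -> (forall e, P e -> exists t r, 0 < t /\ D (t *: e, r)) ->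
  exists N M, nbhs 0 N /\ forall z, N z -> P z -> D (z, M).
Proof.
move=> hV cD upD [B /finite_seqP[s sB] PE] absD.
have Plin : linear_subspace P by rewrite PE; exact: lin_linear_subspace.
have sP b : b \in s -> P b.
  by move=> bs; rewrite PE => L [_]; apply; rewrite sB.
have [pi piP pis] := finite_rank_projection hV Plin sP.
have [N [M [N0 DN]]] := finite_rank_bounded cD upD Plin absD piP.
exists N, M; split => // z Nz Pz.
have <- : pi z = z; last exact: DN.
have zB : lin B z by rewrite -PE.
apply: (zB [set x | pi x = x]); split; last by rewrite sB => b; exact: pis.
split=> [|a x y /= xE yE].
  exact: finite_rank_at0 piP.
by rewrite (finite_rank_linear piP) xE yE.
Qed.

End FiniteRank.

(** * The open mapping argument in Frechet spaces *)

Lemma nbhs_affine (R : realType) (V : tvsType R) (a : R) (v x : V) (B : set V) :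
  a != 0 -> nbhs (a *: x + v) B -> nbhs x [set y | B (a *: y + v)].
Proof.
move=> a0 /nbhs_add/(nbhs0_scale a0)/(nbhs_sub x).
apply: filterS => y /=.
by rewrite scalerBr addrC addrA subrK.
Qed.

Lemma closure_convex_combination (R : realType) (V : tvsType R) (Q : set V)
    (a b : R) (x v : V) :
  convex_set Q -> 0 < a -> 0 <= b -> a + b = 1 -> closure Q x -> Q v ->
  closure Q (a *: x + b *: v).
Proof.
move=> /convex_setP cQ a0 b0 ab Qx Qv B.
move=> /(nbhs_affine (lt0r_neq0 a0))/Qx[q [Qq Bq]].
by exists (a *: q + b *: v); split => //; apply: cQ => //; exact: ltW.
Qed.

Lemma exp_half_lt (R : realType) (c e : R) : 0 < e ->
  exists n : nat, c * 2^-1 ^+ n < e.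
Proof.
move=> e0; pose n := Num.bound (c / e); exists n.
have [c0|c0] := leP c 0.
  by rewrite (le_lt_trans _ e0)// mulr_le0_ge0// exprn_ge0.
have ce : c / e < n%:R by apply: archi_boundP; rewrite divr_ge0// ltW.
rewrite exprVn ltr_pdivrMr ?exprn_gt0// mulrC -ltr_pdivrMr//.
by rewrite (lt_trans ce)// -natrX ltr_nat ltn_expl.
Qed.

Section FrechetMetric.
Context {R : realType} {V : tvsType R} (d : V -> V -> R).
Context (d0 : forall x y, d x y = 0 <-> x = y) (dC : forall x y, d x y = d y x)
  (dtri : forall x y z, d x z <= d x y + d y z)
  (dnbhs : forall x (U : set V), nbhs x U <->
          exists2 e : R, 0 < e & [set y | d x y < e] `<=` U)
  (dcomplete : forall u : nat -> V,
          (forall e : R, 0 < e -> exists N : nat, forall m n : nat,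
             (N <= m)%N -> (N <= n)%N -> d (u m) (u n) < e) ->
          exists l : V, u @ \oo --> l).

Lemma metric_ball_nbhs x (e : R) : 0 < e -> nbhs x [set y | d x y < e].
Proof. by move=> e0; apply/dnbhs; exists e. Qed.

Lemma halving_steps_cvg (u : nat -> V) (e : nat -> R) :
  (forall n, 0 <= e n) -> (forall n, e n.+1 <= e n / 2) ->
  (forall n, d (u n) (u n.+1) <= e n / 2) ->
  exists2 l, u @ \oo --> l & forall n, d (u n) l <= e n.
Proof.
move=> e_ge0 e_half u_half.
have e_exp n : e n <= e 0%N * 2^-1 ^+ n.
  elim: n => [|n IH]; first by rewrite expr0 mulr1.
  rewrite (le_trans (e_half n))// exprSr mulrA ler_wpM2r//.
have u_dist n m : (n <= m)%N -> d (u n) (u m) <= e n - e m.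
  move=> /subnK <-; elim: (m - n)%N => [|k IH].
    by rewrite add0n subrr; have [_ ->] := d0 (u n) (u n).
  rewrite addSn (le_trans (dtri _ (u (k + n)%N) _))//.
  have := e_half (k + n)%N; have := u_half (k + n)%N; move: IH; lra.
have [l ul] : exists l : V, u @ \oo --> l.
  apply: dcomplete => r r0.
  have r2 : 0 < r / 2 by rewrite divr_gt0.
  have [N /(le_lt_trans (e_exp N)) eN] := exp_half_lt (e 0%N) r2.
  exists N => m n Nm Nn.
  have := u_dist _ _ Nm; have := u_dist _ _ Nn.
  have := e_ge0 m; have := e_ge0 n.
  have := dtri (u m) (u N) (u n); rewrite (dC (u m) (u N)); move: eN; lra.
exists l => // n; apply/ler_addgt0Pr => r r0.
have [N _ /(_ (maxn N n)) uN] := ul _ (metric_ball_nbhs l r0).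
have {}uN : d l (u (maxn N n)) < r by apply: uN => /=; exact: leq_maxl.
have := u_dist n (maxn N n) (leq_maxr _ _).
have := e_ge0 (maxn N n); have := dtri (u n) (u (maxn N n)) l.
rewrite (dC (u (maxn N n)) l); move: uN; lra.
Qed.

(** Baire's argument with explicit balls: otherwise there are nested balls
    centred in $P$, the $k$-th one missing $A_k$, and the limit of their centres
    is a point of $P$ outside every $A_k$. *)
Lemma baire_closed_cover (P : set V) (A : nat -> set V) :
  closed P -> P !=set0 -> (forall k, closed (A k)) ->
  (forall z, P z -> exists k, A k z) ->
  exists k z e, [/\ P z, 0 < e & forall y, P y -> d z y < e -> A k y].
Proof.
move=> Pclosed [z0 Pz0] Aclosed PA; apply: contrapT => noball.
have step (p : nat * (V * R)) : exists q : V * R, P p.2.1 -> 0 < p.2.2 ->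
    [/\ P q.1, 0 < q.2, q.2 <= p.2.2 / 2, d p.2.1 q.1 <= p.2.2 / 2 &
        forall y, d q.1 y <= q.2 -> ~ A p.1 y].
  case: p => k [z e] /=.
  have [[Pz e0]|nze] := pselect (P z /\ 0 < e); last by exists (z, e) => Pz e0; case: nze.
  have [z' [Pz' zz' nAz']] : exists y, [/\ P y, d z y < e / 2 & ~ A k y].
    apply: contrapT => noy; apply: noball; exists k, z, (e / 2).
    split; [by []|by rewrite divr_gt0|move=> y Py zy].
    by apply: contrapT => nA; apply: noy; exists y.
  have : nbhs z' (~` A k) by apply: open_nbhs_nbhs; split => //; exact: closed_openC.
  move=> /dnbhs[r r0 rA].
  exists (z', Num.min (e / 2) (r / 2)) => _ _ /=; split => //.
  - by rewrite lt_min !divr_gt0.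
  - by rewrite ge_min lexx.
  - exact: ltW.
  - move=> y; rewrite le_min => /andP[_ yr]; apply: rA => /=.
    by rewrite (le_lt_trans yr)// ltr_pdivrMr// ltr_pMr// ltr1n.
have [f fP] := choice step.
pose s := fix s n := if n is m.+1 then f (m, s m) else (z0, 1 : R).
have sP n : P (s n).1 /\ 0 < (s n).2.
  by elim: n => [|n [Pn en]]; [split=> //=|have [] := fP (n, s n) Pn en].
have sstep n := fP (n, s n) (proj1 (sP n)) (proj2 (sP n)).
have [|||l sl ls] := @halving_steps_cvg (fun n => (s n).1) (fun n => (s n).2).
- by move=> n; rewrite ltW//; case: (sP n).
- by move=> n; case: (sstep n).
- by move=> n; case: (sstep n).
have Pl : P l.
  apply: (closed_cvg _ Pclosed _ _ sl); apply: nearW => n; exact: (proj1 (sP n)).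
have [k Al] := PA _ Pl.
have [_ _ _ _ notA] := sstep k.
exact: (notA l (ls k.+1) Al).
Qed.

(** The closure of an absorbing convex set $Q$ has an interior point by Baire;
    averaging it with a point of $Q$ in the opposite direction brings that
    interior point to $0$. *)
Lemma closure_absorbing_nbhs (P Q : set V) :
  closed P -> linear_subspace P -> convex_set Q ->
  (forall z, P z -> exists2 t : R, 0 < t & Q (t *: z)) ->
  exists2 N, nbhs 0 N & forall z, N z -> P z -> closure Q z.
Proof.
move=> Pclosed Plin Qconvex Qabs.
have Q0 : Q 0 by have [t _] := Qabs 0 (proj1 Plin); rewrite scaler0.
pose a k : R := k.+1%:R^-1.
have a0 k : 0 < a k by rewrite invr_gt0.
pose A k := [set z | closure Q (a k *: z)].
have [||z Pz|k [z [e [Pz e0 zA]]]] := @baire_closed_cover P A Pclosed.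
- by exists 0; case: Plin.
- move=> k; apply: (@closed_comp _ _ ( *:%R (a k))); last exact: closed_closure.
  move=> x _ B /=; rewrite -[_ *: x]addr0.
  move=> /(nbhs_affine (lt0r_neq0 (a0 k))).
  by apply: filterS => y /=; rewrite addr0.
- have [t t0 Qt] := Qabs z Pz.
  pose k := Num.bound t^-1; exists k; apply: subset_closure.
  have akt : a k <= t.
    rewrite /a invf_ple ?posrE//.
    have : t^-1 < k%:R by apply: archi_boundP; rewrite invr_ge0 ltW.
    by move=> /ltW/le_trans; apply; rewrite ler_nat.
  have -> : a k *: z = (a k / t) *: (t *: z) by rewrite scalerA divfK// gt_eqF.
  apply: convex_set_scale_le => //.
  by rewrite divr_ge0 ?(ltW (a0 k)) ?(ltW t0)//= ler_pdivrMr// mul1r.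
have [t t0 Qt] : exists2 t : R, 0 < t & Q (t *: - (a k *: z)).
  by apply: Qabs; rewrite -scaleNr; exact: linear_subspace_scale.
have t1 : 0 < 1 + t by rewrite addr_gt0.
have tn0 : t != 0 by rewrite gt_eqF.
have t1n0 : 1 + t != 0 by rewrite gt_eqF.
(* This makes $w$ a weighted average of $a_k (z + c w)$ and $- t a_k z$. *)
pose c := (a k)^-1 * ((1 + t) / t).
have c0 : c != 0 by rewrite /c !mulf_neq0// ?invr_eq0// gt_eqF.
exists [set w | d z (z + c *: w) < e].
  exact: (nbhs0_scale c0 (nbhs_add (metric_ball_nbhs z e0))).
move=> w /= wz Pw.
have : closure Q (a k *: (z + c *: w)).
  by apply: zA => //; rewrite addrC; apply: (proj2 Plin).
move=> Qw.
have s0 : 0 < t / (1 + t) by rewrite divr_gt0.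
have s1 : 0 <= (1 + t)^-1 by rewrite invr_ge0 ltW.
have s01 : t / (1 + t) + (1 + t)^-1 = 1 by field.
have := closure_convex_combination Qconvex s0 s1 s01 Qw Qt.
congr (closure Q _).
have mE : t / (1 + t) * (a k * c) = 1.
  rewrite /c [a k * _]mulrA divff ?gt_eqF// mul1r; field.
  by rewrite tn0.
rewrite scalerA scalerDr scalerA -[_ * a k * c]mulrA mE scale1r addrAC.
by rewrite !scalerN !scalerA [(1 + t)^-1 * t]mulrC subrr add0r.
Qed.

End FrechetMetric.

(** Points of $W$ over approximations of $2y$, $2(2y - z_0)$, ... are combined
    with weights $1/2, 1/4$, ...: the second coordinates sum to $y$, and the
    first ones converge because they are taken in shrinking neighbourhoods of
    $x_0$. *)
Theorem convex_range_nbhs (R : realType) (X Z : tvsType R) (W : set (X * Z))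
    (P : set Z) (x0 : X) :
  frechet X -> frechet Z -> closed W -> convex_set W -> W (x0, 0) ->
  closed P -> linear_subspace P -> (forall x z, W (x, z) -> P z) ->
  (forall z, P z -> exists2 t : R, 0 < t & exists x, W (x, t *: z)) ->
  exists2 N, nbhs 0 N & forall z, N z -> P z -> exists x, W (x, z).
Proof.
move=> [dX [[dX0 dXC dXtri] dXinv dXnbhs dXcomplete]].
move=> [dZ [[dZ0 dZC dZtri] dZinv dZnbhs dZcomplete]].
move=> Wclosed Wconvex W0 Pclosed Plin WP Pabs.
have /convex_setP cW := Wconvex.
have cW' a b x y z t : 0 <= a -> 0 <= b -> a + b = 1 -> W (x, z) -> W (y, t) ->
    W (a *: x + b *: y, a *: z + b *: t).
  by move=> a0 b0 ab Wx Wy; exact: (cW a b (x, z) (y, t)).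
pose h : R := 2^-1.
have h0 : 0 < h by rewrite invr_gt0.
have hh : h + h = 1 by rewrite /h; lra.
have h2 : h * 2 = 1 by rewrite mulVf.
have hn0 n : 0 < h ^+ n by rewrite exprn_gt0.
have hn1 n : h ^+ n <= 1.
  by rewrite exprn_ile1// ?ltW// invf_lt1// ltr1n.
have small (V : tvsType R) (d : V -> V -> R) : (forall x (U : set V), nbhs x U <->
    exists2 e : R, 0 < e & [set y | d x y < e] `<=` U) ->
    forall n (N : set V), nbhs 0 N -> exists U : set V,
      [/\ nbhs 0 U, U `<=` N, convex_set U, (forall u, U u -> U (- u)) &
          U `<=` [set u | d 0 u < h ^+ n]].
  move=> dnbhs n N N0.
  have [|U [U0 UN Uconvex Usym]] :=
      @nbhs0_convex_symmetric R V (N `&` [set u | d 0 u < h ^+ n]).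
    by apply: filterI => //; exact: metric_ball_nbhs.
  by exists U; split => // u /UN[].
have [U UP] := choice (fun n => small X dX dXnbhs n setT filterT).
have U0 n : U n 0 by have [/nbhs_singleton] := UP n.
pose Q n := [set z | exists2 x, U n (x - x0) & W (x, z)].
have Qconvex n : convex_set (Q n).
  apply/convex_setP => a b z t a0 b0 ab [x Ux Wx] [y Uy Wy].
  exists (a *: x + b *: y); last exact: cW'.
  rewrite convex_combination_sub//.
  have [_ _ /convex_setP cU _ _] := UP n; exact: cU.
have Qabs n z : P z -> exists2 t : R, 0 < t & Q n (t *: z).
  move=> /Pabs[t t0 [x Wx]].
  have [nU _ _ _ _] := UP n.
  have [s s0 sU] := nbhs0_absorbing (x - x0) nU.
  pose r := Num.min s 1.
  have r0 : 0 < r by rewrite lt_min s0 ltr01.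
  have r1 : 0 <= 1 - r by rewrite subr_ge0 ge_min lexx orbT.
  exists (r * t); first exact: mulr_gt0.
  exists (r *: x + (1 - r) *: x0).
    have -> : r *: x + (1 - r) *: x0 - x0 = r *: (x - x0).
      by rewrite scalerBl scale1r scalerBr addrA addrAC addrK.
    by apply: sU; rewrite gtr0_norm// ge_min lexx.
  have := cW' r (1 - r) x x0 (t *: z) 0 (ltW r0) r1 _ Wx W0.
  by rewrite scaler0 addr0 scalerA addrC subrK; apply.
have N_ex n : exists N : set Z, [/\ nbhs 0 N,
    (forall z, N z -> P z -> closure (Q n) z), convex_set N,
    (forall u, N u -> N (- u)) & N `<=` [set u | dZ 0 u < h ^+ n]].
  have [M M0 MQ] := closure_absorbing_nbhs dZ0 dZC dZtri dZnbhs dZcomplete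
    Pclosed Plin (Qconvex n) (Qabs n).
  have [L [L0 LM Lconvex Lsym Ld]] := small Z dZ dZnbhs n M M0.
  by exists L; split => // z /LM; exact: MQ.
have [N NP] := choice N_ex.
(* A point of $Q_n$ close to $w$: the remaining error, doubled, is in $N_{n+1}$. *)
have step (p : nat * Z) : exists q : X * Z, N p.1 p.2 -> P p.2 ->
    [/\ U p.1 (q.1 - x0), W q & N p.1.+1 (2 *: (p.2 - q.2))].
  case: p => n w /=.
  have [[Nw Pw]|nw] := pselect (N n w /\ P w); last by exists (0, 0) => Nw Pw; case: nw.
  have [_ NQ _ _ _] := NP n; have [N'0 _ _ _ _] := NP n.+1.
  have n2 : - 2 != 0 :> R by rewrite oppr_eq0.
  have [z [[x Ux Wx] /= Nz]] := NQ _ Nw Pw _ (nbhs_sub w (nbhs0_scale n2 N'0)).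
  exists (x, z) => _ _; split => //=.
  by move: Nz; rewrite scaleNr -scalerN opprB.
have [f fP] := choice step.
exists [set y | N 0%N (2 *: y)].
  by apply: nbhs0_scale => //; have [] := NP 0%N.
move=> y /= Ny Py.
(* $w_n$ is the error of the first $n$ approximations, rescaled to lie in $N_n$:
   see [yE] below. *)
pose w := fix w n := if n is m.+1 then 2 *: (w m - (f (m, w m)).2) else 2 *: y.
pose x n := (f (n, w n)).1.
pose z n := (f (n, w n)).2.
have wS n : w n.+1 = 2 *: (w n - z n) by [].
have wP n : N n (w n) /\ P (w n).
  elim: n => [|n [Nw Pw]]; first by split => //; exact: linear_subspace_scale.
  have [_ Wq Nq] := fP (n, w n) Nw Pw; split; first exact: Nq.
  rewrite wS; apply: linear_subspace_scale => //.
  rewrite addrC -scaleN1r; apply: (proj2 Plin) => //.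
  by apply: (WP (x n)); rewrite -surjective_pairing.
have xU n : U n (x n - x0) by have [] := fP (n, w n) (proj1 (wP n)) (proj2 (wP n)).
have xzW n : W (x n, z n).
  have [_ Wq _] := fP (n, w n) (proj1 (wP n)) (proj2 (wP n)).
  by rewrite -surjective_pairing.
pose u n := x0 + \sum_(k < n) h ^+ k.+1 *: (x k - x0).
pose v n := \sum_(k < n) h ^+ k.+1 *: z k.
have uS n : u n.+1 = u n + h ^+ n.+1 *: (x n - x0) by rewrite /u big_ord_recr addrA.
have vS n : v n.+1 = v n + h ^+ n.+1 *: z n by rewrite /v big_ord_recr.
have yE n : y = v n + h ^+ n.+1 *: w n.
  elim: n => [|n {1}->].
    by rewrite /v big_ord0 add0r expr1 scalerA mulVf// scale1r.
  rewrite vS wS -addrA scalerA [h ^+ n.+2]exprSr -mulrA h2 mulr1 -scalerDr.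
  by rewrite [z n + _]addrC subrK.
(* The weight $2^{-n}$ left over after $n$ terms may go to any point of $W$. *)
have uvW n : forall a b, W (a, b) -> W (u n + h ^+ n *: (a - x0), v n + h ^+ n *: b).
  elim: n => [a b Wab|n IH a b Wab].
    by rewrite /u /v !big_ord0 !expr0 !scale1r addr0 add0r addrC subrK.
  have := IH _ _ (cW' h h _ _ _ _ (ltW h0) (ltW h0) hh (xzW n) Wab).
  have -> : h *: x n + h *: a - x0 = h *: ((x n - x0) + (a - x0)).
    by rewrite [RHS]scalerDr convex_combination_sub.
  by rewrite uS vS -scalerDr !scalerA -!exprSr !scalerDr !addrA.
have uvW0 n : W (u n, v n).
  by have := uvW n _ _ W0; rewrite subrr !scaler0 !addr0.
have shrink (V : tvsType R) (d : V -> V -> R) (M : nat -> set V) :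
    (forall x y z, d (x + z) (y + z) = d x y) ->
    (forall n, [/\ nbhs 0 (M n), convex_set (M n) &
        M n `<=` [set u | d 0 u < h ^+ n]]) ->
    forall n c a, M n a -> d c (c + h ^+ n.+1 *: a) < h ^+ n.
  move=> dinv MP n c a Ma; have [M0 Mconvex Md] := MP n.
  rewrite -{1}[c]add0r [c + _]addrC dinv; apply: Md.
  apply: convex_set_scale_le => //; first exact: nbhs_singleton.
  by rewrite (ltW (hn0 _)) hn1.
have [|||l ul _] := @halving_steps_cvg R X dX dX0 dXC dXtri dXnbhs dXcomplete
    u (fun n => 2 * h ^+ n).
- by move=> n; rewrite mulr_ge0// ltW.
- by move=> n; rewrite exprSr mulrA.
- move=> n; rewrite mulrAC divff// mul1r uS ltW//.
  by apply: (shrink X dX U) => // k; have [] := UP k.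
have vy : v @ \oo --> y.
  move=> B /dZnbhs[e e0 eB].
  have [m me] := exp_half_lt 1 e0.
  exists m => // n /= mn; apply: eB => /=.
  rewrite dZC (yE n) (lt_le_trans (shrink Z dZ N dZinv _ n _ _ _))//.
  - by move=> k; have [] := NP k.
  - by have [] := wP n.
  - move: me; rewrite mul1r => /ltW; apply: le_trans.
    by rewrite ler_wiXn2l// ltW// invf_lt1// ltr1n.
exists l.
apply: (@closed_cvg _ _ \oo _ (fun n => (u n, v n)) W Wclosed); last first.
  exact: cvg_pair.
by apply: nearW.
Qed.

(** * Cones with interior and scalarization *)

Section Cones.
Context {R : realType} {V : tvsType R}.
Implicit Types (K Q : set V).

Lemma cone_add K x y : convex_set K -> cone K -> K x -> K y -> K (x + y).
Proof.
move=> /convex_setP cK hK Kx Ky.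
have -> : x + y = 2 *: (2^-1 *: x + 2^-1 *: y).
  by rewrite -scalerDr scalerA divff// scale1r.
by apply: hK => //; apply: cK => //; lra.
Qed.

Lemma cone0 K : cone K -> K !=set0 -> K 0.
Proof. by move=> hK [x /(hK _ _ (lexx 0))]; rewrite scale0r. Qed.

Lemma interior_cone_add K x y : convex_set K -> cone K -> K° x -> K y -> K° (x + y).
Proof.
move=> cK hK Kx Ky; have /(nbhsB y) := Kx; rewrite addrC.
by apply: filterS => _ [u Ku <-]; exact: cone_add.
Qed.

Lemma interior_cone_scale K (t : R) x : cone K -> 0 < t -> K° x -> K° (t *: x).
Proof.
move=> hK t0 Kx; have := nbhsZ (lt0r_neq0 t0) Kx.
by apply: filterS => _ [u Ku <-]; apply: hK => //; exact: ltW.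
Qed.

Lemma interior_sub_scale K x u : K° x -> exists2 t : R, 0 < t & K (x - t *: u).
Proof.
move=> /nbhs_add/(nbhs0_absorbing u)[t t0 tK].
by exists t => //; rewrite -scaleNr; apply: tK; rewrite normrN gtr0_norm.
Qed.

(** The relation $z + r k_0 \in Q$ takes the value $1$ near $0$ because $k_0$ is
    interior to $K \subset Q$, and no negative value over $0$ because $Q$ misses
    $- int K$. Its minorant $l$ satisfies $l(k_0) = -1$, since $0 \in Q$ gives
    the relation the values $-1$ at $k_0$ and $1$ at $- k_0$; take $f = - l$. *)
Lemma scalarization K Q k0 : convex_set K -> cone K -> K° k0 -> convex_set Q ->
  K `<=` Q -> (forall k, K° k -> ~ Q (- k)) ->
  exists f : {scalar V}, [/\ continuous f, f k0 = 1 & forall v, Q v -> 0 <= f v].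
Proof.
move=> cK hK Kk0 /convex_setP cQ KQ Qint.
have K0 : K 0 by apply: cone0 => //; exists k0; exact: interior_subset.
pose D : set (V * R^o) := [set p | Q (p.1 + p.2 *: k0)].
have [|||z Kz|l lc lD] := @bounded_linear_minorant R V D [set z | K (k0 + z)] 1.
- apply/convex_setP => a b [x r] [y s] a0 b0 ab Dx Dy.
  have := cQ _ _ _ _ a0 b0 ab Dx Dy; rewrite /D /=; congr Q.
  by rewrite !scalerDr !scalerA addrACA -scalerDl.
- move=> r; rewrite /D /= add0r => Qr; rewrite leNgt; apply/negP => r0.
  apply: (Qint (- r *: k0)); last by rewrite scaleNr opprK.
  by apply: interior_cone_scale; rewrite ?oppr_gt0.
- exact: nbhs_add.
- by rewrite /D /= scale1r addrC; exact: KQ.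
exists (\- l); split.
- by move=> x; apply: (@cvgN _ _ _ _ _ l); exact: lc.
- apply/eqP; rewrite eq_le /=; apply/andP; split.
    rewrite -linearN; apply: lD.
    by rewrite /D /= scale1r addNr; exact: KQ.
  rewrite lerNr; apply: lD.
  by rewrite /D /= scaleN1r subrr; exact: KQ.
- move=> v Qv; rewrite /= oppr_ge0; apply: lD.
  by rewrite /D /= scale0r addr0.
Qed.

End Cones.

(** * Lagrange multipliers and strong duality *)

Lemma epi_value (R : realType) (X V : tvsType R) (K : set V) (F : X -> \bar V) x a :
  K 0 -> F x = a%:E -> epi K F (x, a).
Proof. by move=> K0 Fx; exists 0; rewrite //= Fx -[in LHS](addr0 a). Qed.

Section Duality.
Context {R : realType} {X Y Z : tvsType R}.
Context (K : set Y) (hK0 : K 0).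
Context (S : set Z).
Context (F : X -> \bar Y) (hFproper : proper_mapping F) (hFconvex : K_convex K F).
Context (C : set X) (hCconvex : convex_set C).
Context (G : X -> \bar Z) (hGconvex : K_convex S G).

(** Written with epigraphs, so that the three conditions are jointly convex in
    $(x, y, z)$. *)
Definition dominated x y z := [/\ C x, epi K F (x, y) & epi S G (x, z)].

Lemma dominated_convex a b x y z x' y' z' : 0 <= a -> 0 <= b -> a + b = 1 ->
  dominated x y z -> dominated x' y' z' ->
  dominated (a *: x + b *: x') (a *: y + b *: y') (a *: z + b *: z').
Proof.
move=> a0 b0 ab [Cx Fx Gx] [Cx' Fx' Gx'].
have /convex_setP cC := hCconvex; have /convex_setP cF := hFconvex.
have /convex_setP cG := hGconvex.
split; [exact: cC|exact: (cF a b (x, y) (x', y'))|].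
exact: (cG a b (x, z) (x', z')).
Qed.

Context (f : {scalar Y}) (fK : forall k, K k -> 0 <= f k) (y0 : Y).

(** The infimum over the fibre at $z$ is the value
    $\inf \{f(F(x)) - f(y_0) : x \in C, G(x) \in z - S\}$ of the perturbed
    scalarized problem, so the linear minorants of this relation are the
    Lagrange multipliers. *)
Definition value_set : set (Z * R^o) := [set p | exists x y,
  dominated x y p.1 /\ f (y - y0) <= p.2].

Lemma value_set_convex : convex_set value_set.
Proof.
apply/convex_setP => a b [z r] [w s] a0 b0 ab
  [x1 [y1 [xyz1 f1]]] [x2 [y2 [xyz2 f2]]].
exists (a *: x1 + b *: x2), (a *: y1 + b *: y2).
split; first exact: dominated_convex.
by rewrite convex_combination_sub// linearD !linearZ/= lerD// ler_wpM2l.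
Qed.

Lemma value_set_le z r s : value_set (z, r) -> r <= s -> value_set (z, s).
Proof. by move=> [x [y [xyz fy]]] rs; exists x, y; split => //; exact: le_trans rs. Qed.

Lemma E_set_value z : E_set S C F G z <-> exists r, value_set (z, r).
Proof.
have [_ Fninf] := hFproper; split.
  move=> [x [s [[[Cx dFx] dGx] [Ss zE]]]].
  case Fx : (F x) => [a||]; [|by []|by case: (Fninf x Fx)].
  exists (f (a - y0)), x, a; split => //; split => //; last by exists s.
  exact: epi_value.
move=> [r [x [y [[Cx [k Kk Fx] [s Ss Gx]] _]]]].
exists x, s; split; [split; [split|]|] => //= oo.
- by move: Fx; rewrite /= oo.
- by move: Gx; rewrite /= oo.
Qed.

Context (x0 : X) (hx0 : dominated x0 y0 0).

Lemma value_set0 : value_set (0, 0).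
Proof. by exists x0, y0; rewrite subrr (linear0 f). Qed.

Lemma value_set_ray z r (t : R) : value_set (z, r) -> 0 <= t <= 1 ->
  value_set (t *: z, t * r).
Proof.
move=> Dz /andP[t0 t1].
have /convex_setP cD := value_set_convex.
have := cD t (1 - t) (z, r) (0, 0) t0; rewrite subr_ge0 addrC subrK.
move=> /(_ t1 erefl Dz value_set0).
by congr (value_set (_, _)); rewrite /= ?scaler0 ?addr0// /GRing.scale/= mulr0 addr0.
Qed.

(** The value at $0$ being at most $0$, convexity makes the values on a ray small
    near $0$; so the bound $1$ holds on an absorbing set. *)
Lemma value_set_small z r : value_set (z, r) ->
  exists2 t : R, 0 < t & value_set (t *: z, 1).
Proof.
move=> Dz; have r1 : 0 < 1 + `|r| by rewrite ltr_wpDr.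
exists (1 + `|r|)^-1; first by rewrite invr_gt0.
have t01 : 0 <= (1 + `|r|)^-1 <= 1.
  by rewrite invr_ge0 (ltW r1) invf_le1// lerDl normr_ge0.
apply: value_set_le (value_set_ray Dz t01) _.
by rewrite mulrC ler_pdivrMr// mul1r (le_trans (ler_norm r))// lerDr ler01.
Qed.

(** The Slater point $x$ is feasible for all perturbations $z$ near $0$. *)
Lemma c1_bounded : cond_c1 S C F G ->
  exists N M, nbhs 0 N /\ forall z, N z -> value_set (z, M).
Proof.
move=> [x [Cx dFx [s Ss Gx]]]; have [_ Fninf] := hFproper.
case Fx : (F x) => [a||]; [|by []|by case: (Fninf x Fx)].
exists [set z | S (s + z)], (f (a - y0)); split; first exact: nbhs_add.
move=> z Sz; exists x, a; split => //; split => //; first exact: epi_value.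
by exists (s + z); rewrite //= -Gx -[in LHS](addKr s z).
Qed.

(** The sublevel set $W$ is closed since $f \circ F$ is lower semicontinuous and
    the epigraph of $G$ is closed; its projection absorbs the closed subspace
    $P$ generated by $E$. *)
Lemma c2_bounded : cond_c2 S C F G -> continuous f -> exists P N M,
  [/\ linear_subspace P, (forall z r, value_set (z, r) -> P z), nbhs 0 N &
      forall z, N z -> P z -> value_set (z, M)].
Proof.
move=> [[hX hZ] Cclosed Flsc Gclosed [E0]].
set P := [set z | _] => -[Pclosed Plin] fc.
have [_ Fninf] := hFproper.
have valP z r : value_set (z, r) -> P z.
  move=> Dz; exists 1, z; split => //; last by rewrite subr0 scale1r.
  by apply/E_set_value; exists r.
pose W : set (X * Z) := [set p | exists y, dominated p.1 y p.2 /\ f (y - y0) <= 1].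
have Wconvex : convex_set W.
  apply/convex_setP => a b [x z] [x' z'] a0 b0 ab [y [xyz fx]] [y' [xyz' fx']].
  exists (a *: y + b *: y'); split; first exact: dominated_convex.
  rewrite convex_combination_sub// linearD !linearZ/= -[leRHS]ab.
  by rewrite lerD// -[leRHS]mulr1 ler_wpM2l.
have WE : W = (fst @^-1` C) `&` (fst @^-1` [set x | (er_map f (F x) <= (f y0 + 1)%:E)%E])
    `&` epi S G.
  apply/seteqP; split=> [[x z]|[x z] /= [[Cx Fx] Gx]].
    move=> [y [[Cx [k Kk Fx] Gx] fx]]; split => //; split => //=.
    move: Fx; case: (F x) => [a||] //= [yE].
    move: fx; rewrite yE linearB linearD/= lee_fin.
    have := fK Kk; lra.
  move: Fx; case Fx : (F x) => [a||] //=; last by case: (Fninf x Fx).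
  rewrite lee_fin => fa; exists a; split; first by split => //; exact: epi_value.
  by rewrite linearB/= lerBlDl.
have Wclosed : closed W.
  rewrite WE; apply: closedI => //; apply: closedI.
    by apply: closed_comp => // x _; exact: cvg_fst.
  apply: closed_comp; first by move=> x _; exact: cvg_fst.
  have /lower_semicontinuousP/(_ (f y0 + 1)) := Flsc f fc.
  rewrite -closedC; congr closed; apply/seteqP.
  by split=> x /=; rewrite leNgt => /negP.
have Wabs z : P z -> exists2 t : R, 0 < t & exists x, W (x, t *: z).
  move=> [l [v [l0 /E_set_value[r Dv] ->]]]; rewrite subr0.
  have [t t0 [x [y xy]]] := value_set_small Dv.
  move: l0; rewrite le_eqVlt => /predU1P[<-|l0].
    by exists 1 => //; exists x0, y0; rewrite scale0r scaler0 subrr (linear0 f).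
  exists (t / l); first by rewrite divr_gt0.
  by exists x, y; rewrite scalerA divfK// gt_eqF.
have W0 : W (x0, 0) by exists y0; rewrite subrr (linear0 f).
have [N N0 NW] := convex_range_nbhs hX hZ Wclosed Wconvex W0 Pclosed Plin
  (fun x z Wx => valP z 1 (ex_intro _ x Wx)) Wabs.
by exists P, N, 1; split => // z Nz /(NW z Nz)[x Wx]; exists x.
Qed.

(** As $0 \in E$, the affine hull of $E$ is its linear hull, so that
    $0 \in ri E$ makes $E$ absorbing in $lin E$. *)
Lemma c3_bounded (hZ : hausdorff_space Z) : cond_c3 S C F G -> exists P N M,
  [/\ linear_subspace P, (forall z r, value_set (z, r) -> P z), nbhs 0 N &
      forall z, N z -> P z -> value_set (z, M)].
Proof.
move=> [Efin [E0 Eri]]; set E := E_set S C F G in Efin E0 Eri.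
have linaff z : lin E z -> aff E z.
  move=> Ez L [Laff EL]; apply: Ez; split => //.
  have L0 : L 0 by exact: EL.
  have LZ a x : L x -> L (a *: x).
    by move=> Lx; have := Laff a 0 x L0 Lx; rewrite scaler0 add0r.
  split => // a x y /(LZ a) Lx Ly.
  have := LZ 2 _ (Laff 2^-1 _ _ Lx Ly); congr (L _).
  have -> : 1 - 2^-1 = 2^-1 :> R by lra.
  by rewrite -scalerDr scalerA divff// scale1r.
have Eabs e : lin E e -> exists t r, 0 < t /\ value_set (t *: e, r).
  move=> Ee; have [t t0 tE] := nbhs0_absorbing e Eri.
  have /E_set_value[r Dr] : E (t *: e).
    apply: (tE t); first by rewrite gtr0_norm.
    by apply: linaff; exact: (linear_subspace_scale t (lin_linear_subspace E) Ee).
  by exists t, r.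
have [N [M [N0 DN]]] := finite_dim_absorbing_bounded hZ value_set_convex
  value_set_le Efin Eabs.
exists (lin E), N, M; split => //; first exact: lin_linear_subspace.
by move=> z r Dz L [_]; apply; apply/E_set_value; exists r.
Qed.

Lemma lagrange_multiplier (hZ : hausdorff_space Z) : continuous f ->
  (forall r, value_set (0, r) -> 0 <= r) ->
  cond_c1 S C F G \/ cond_c2 S C F G \/ cond_c3 S C F G ->
  exists2 l : {scalar Z}, continuous l &
    forall x y z, dominated x y z -> l z <= f (y - y0).
Proof.
move=> fc val_ge0 hc.
suff [P [N [M [Plin valP N0 DN]]]] : exists P N M,
    [/\ linear_subspace P, (forall z r, value_set (z, r) -> P z), nbhs 0 N &
        forall z, N z -> P z -> value_set (z, M)].
  have [l lc lD] := subspace_linear_minorant value_set_convex val_ge0 Plin valP N0 DN.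
  by exists l => // x y z xyz; apply: lD; exists x, y.
move: hc => [/c1_bounded[N [M [N0 DN]]]|[/c2_bounded/(_ fc)//|/(c3_bounded hZ)//]].
by exists setT, N, M; split => // z Nz _; exact: DN.
Qed.

End Duality.

(** * Weak duality and the main theorem *)

Section WeakDuality.
Context {R : realType} {X Y Z : tvsType R} (K : set Y) (S : set Z) (C : set X)
  (F : X -> \bar Y) (G : X -> \bar Z).

(** Weak duality at a feasible $x$ gives the supremum condition: a dual value
    above $F(x)$ would be $F(x) + k$ with $k$ interior, and $-T(G(x)) \in K$. *)
Lemma dual_feasible_value_solution x y T : convex_set K -> cone K ->
  feasible S C G x -> F x = y%:E -> dual_feasible K S C F G (T, y) ->
  dvop_solution K S C F G T y.
Proof.
move=> Kconvex Kcone [Cx [s Ss Gx]] Fx Ty; split => //; split.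
  by exists y => //; exists T.
split=> [_ [y' [T' [[_ T'SK] T'y']] <-]|t ty]; last first.
  by exists y%:E => //; exists y => //; exists T.
move=> [k Kk /= yk]; apply: T'y' => /=.
exists x, (k + T' s); split.
- by split => //; rewrite /dom /= -Gx.
- by apply: interior_cone_add => //; apply: T'SK; exists s.
- rewrite Fx -Gx /=; congr (_%:E).
  have -> : y' = y + k by rewrite -[k]opprK yk opprB addrC subrK.
  by rewrite linearN -addrA [k + _]addrC addKr.
Qed.

End WeakDuality.

Theorem corollary5p5 (R : realType) (X Y Z : tvsType R)
  (hX : hausdorff_space X) (hY : hausdorff_space Y) (hZ : hausdorff_space Z)
  (K : set Y) (hKclosed : closed K) (hKpointed : pointed K)
  (hKconvex : convex_set K) (hKcone : cone K) (hKint : K° !=set0)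
  (S : set Z) (hS0 : S !=set0) (hSclosed : closed S)
  (hSconvex : convex_set S) (hScone : cone S)
  (F : X -> \bar Y) (hFproper : proper_mapping F) (hFconvex : K_convex K F)
  (C : set X) (hC0 : C !=set0) (hCconvex : convex_set C)
  (G : X -> \bar Z) (hGproper : proper_mapping G) (hGconvex : K_convex S G)
  (hAF : feasible S C G `&` dom F !=set0)
  (hc : cond_c1 S C F G \/ cond_c2 S C F G \/ cond_c3 S C F G)
  (xbar : X) (hx : vop_solution K S C F G xbar) :
  exists (T : {linear Z -> Y}) (y : Y),
    dvop_solution K S C F G T y /\ F xbar = y%:E.
Proof.
have [Fninf Gninf] := (proj2 hFproper, proj2 hGproper).
have [xfeas [_ [Fmin _]]] := hx; have [Cxbar [s0 Ss0 Gxbar]] := xfeas.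
have [k0 Kk0] := hKint.
have K0 : K 0 by apply: cone0 => //; exists k0; exact: interior_subset.
have [ybar Fxbar] : exists ybar, F xbar = ybar%:E.
  case Fx : (F xbar) => [y||]; [by exists y| |by case: (Fninf xbar Fx)].
  have [x1 [x1feas x1F]] := hAF; exfalso; apply: (Fmin (F x1)); first by exists x1.
  by rewrite Fx; case Fx1 : (F x1) => [||]; [| |case: (Fninf x1 Fx1)].
have epixbar : epi K F (xbar, ybar).
  exact: epi_value.
(* All $z \in S$ are reached at $\bar x$, so the value function is at most $0$ on
   $S$; this gives $T(S) \subset K$ below. *)
have epiS s : S s -> epi S G (xbar, s).
  move=> Ss; exists (s0 + s); first exact: cone_add.
  by rewrite -Gxbar -[in LHS](addKr s0 s).
have S0 : S 0 by exact: cone0.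
pose Q := [set v | exists x y, dominated K S F C G x y 0 /\ v = y - ybar].
have Qconvex : convex_set Q.
  apply/convex_setP => a b _ _ a0 b0 ab [x1 [y1 [xy1 ->]]] [x2 [y2 [xy2 ->]]].
  exists (a *: x1 + b *: x2), (a *: y1 + b *: y2).
  rewrite convex_combination_sub//; split => //.
  have := dominated_convex hFconvex hCconvex hGconvex a0 b0 ab xy1 xy2.
  by rewrite !scaler0 addr0.
have KQ : K `<=` Q.
  move=> k Kk; exists xbar, (ybar + k); split; last by rewrite addrC addKr.
  by split => //; [exists k => //=; rewrite Fxbar|exact: epiS].
have Qint k : K° k -> ~ Q (- k).
  move=> Kk [x [y [[Cx [k' Kk' /= Fx] [s Ss /= Gx]] yk]]].
  apply: (Fmin (F x)).
    exists x => //; split => //; exists s => //.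
    move: Gx; case: (G x) => [w||] //= [/esym/eqP].
    by rewrite addr_eq0 => /eqP ->.
  move: Fx; case: (F x) => [a||] //= [yE].
  rewrite Fxbar /=; exists (k + k'); first exact: interior_cone_add.
  by rewrite -[k]opprK yk yE opprD opprK addrAC addrK.
have [f [fc fk0 fQ]] := scalarization hKconvex hKcone Kk0 Qconvex KQ Qint.
have fK k : K k -> 0 <= f k by move=> /KQ; exact: fQ.
have fKint k : K° k -> 0 < f k.
  move=> /(interior_sub_scale k0)[t t0 /fK].
  by rewrite linearB linearZ/= fk0 mulr1 subr_ge0; exact: lt_le_trans.
have val_ge0 r : value_set K S F C G f ybar (0, r) -> 0 <= r.
  by move=> [x [y [xy]]]; apply: le_trans; apply: fQ; exists x, y.
have [l lc lD] := lagrange_multiplier K0 hFproper hFconvex hCconvex hGconvex fK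
  (And3 Cxbar epixbar (epiS 0 S0)) hZ fc val_ge0 hc.
(* $f \circ T = - l$ because $f(k_0) = 1$. *)
have Tlin : linear (fun z => - l z *: k0).
  by move=> a z w; rewrite linearP/= opprD scalerDl -mulrN scalerA.
pose Tl := GRing.isLinear.Build R Z Y *:%R (fun z => - l z *: k0) Tlin.
pose T : {linear Z -> Y} := HB.pack (fun z => - l z *: k0) Tl.
exists T, ybar; split => //.
apply: (@dual_feasible_value_solution R X Y Z K S C F G xbar) => //.
split.
  split.
    move=> z; apply: (@continuous_comp _ (R^o * Y)%type _ (fun z => (- l z : R^o, k0))
      (fun p => p.1 *: p.2)); last exact: scale_continuous.
    apply: (@cvg_pair _ _ _ _ (nbhs (- l z : R^o))); last exact: cvg_cst.
    by apply: (@cvgN _ _ _ _ _ l); exact: lc.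
  move=> _ [s Ss <-]; apply: hKcone; last exact: interior_subset.
  rewrite oppr_ge0.
  by have := lD xbar ybar s (And3 Cxbar epixbar (epiS s Ss)); rewrite subrr (linear0 f).
move=> [x [k [[Cx dGx] Kk /=]]].
case Gx : (G x) => [w||]; [|by case: (dGx Gx)|by case: (Gninf x Gx)].
case Fx : (F x) => [a||] //= [yE].
have := lD x a w (And3 Cx (epi_value K0 Fx) (epi_value S0 Gx)).
have := fKint k Kk.
rewrite yE !linearB !linearD/= linearZ/= fk0; lra.
Qed.
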